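(* Let $\mathcal{A}$ be a separable $C^*$-algebra with multiplier algebra $M(\mathcal{A})$, and let $T$ be a regular operator on $\mathcal{A}$ with $z$-transform $z$. Let $S$ be a regular operator on $\mathcal{A}$ with $z$-transform $z_S$. Then $S$ is a restriction of $T$ if and only if $z_S=zu$ for some isometry $u\in M(\mathcal{A})$ (i.e. $u^*u=I$) satisfying $$(u^*(I-z^*z)u)^{1/2}=(I-z^*z)^{1/2}u.$$
   Context: A $C^*$-algebra $\mathcal{A}$ is viewed as a Hilbert module over itself with $\langle a,b\rangle=a^*b$. An operator $T$ on $\mathcal{A}$ is a linear map from a linear subspace $D(T)\subseteq\mathcal{A}$ to $\mathcal{A}$; its adjoint (for $D(T)$ dense) has domain $D(T^* )=\{y:\exists z,\ \langle Tx,y\rangle=\langle x,z\rangle\ \forall x\in D(T)\}$ and $T^*y=z$. $T$ is semiregular if (a) $D(T)$ is a dense right ideal of $\mathcal{A}$, (b) $T$ is closable, (c) $T^*$ is densely defined. $T$ is regular if it is a closed semiregular operator such that the range of $I+T^*T$ is dense in $\mathcal{A}$. A regular operator $T$ on $\mathcal{A}$ is uniquely determined by its $z$-transform (bounded transform) $z=T(I+T^*T)^{-1/2}\in M(\mathcal{A})$; one has $D(T)=(I-z^*z)^{1/2}\mathcal{A}$ and $T(I-z^*z)^{1/2}a=za$ for $a\in\mathcal{A}$. The $z$-transforms of regular operators are exactly the elements $z\in M(\mathcal{A})$ with $\|z\|\le 1$ and $(I-z^*z)^{1/2}\mathcal{A}$ dense in $\mathcal{A}$. $S$ is a restriction of $T$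 (and $T$ an extension of $S$), written $S\subseteq T$, if $D(S)\subseteq D(T)$ and $S=T$ on $D(S)$. *)

(* Defs.v *)
From HB Require Import structures.
From mathcomp Require Import all_boot all_order all_algebra.
From mathcomp Require Import complex.
From mathcomp Require Import all_classical all_reals all_analysis.

Set Implicit Arguments.
Unset Strict Implicit.
Unset Printing Implicit Defensive.

Import Order.TTheory GRing.Theory Num.Theory.
Import numFieldNormedType.Exports.
Local Open Scope classical_set_scope.
Local Open Scope ring_scope.
Local Open Scope complex_scope.

(* MathComp rings are unital, so the (possibly non-unital) multiplication of a
   C*-algebra is an operation of its own, on a complex Banach space. *)
HB.mixin Record isCStarAlgebra (R : realType) A
    of CompleteNormedModule R[i] A := {
  cmul : A -> A -> A;
  cstar : A -> A;
  cmulA : associative cmul;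
  cmulDl : left_distributive cmul +%R;
  cmulDr : right_distributive cmul +%R;
  cmulZl : forall (c : R[i]) (a b : A), cmul (c *: a) b = c *: cmul a b;
  cmulZr : forall (c : R[i]) (a b : A), cmul a (c *: b) = c *: cmul a b;
  cstarD : {morph cstar : a b / a + b};
  cstarZ : forall (c : R[i]) (a : A), cstar (c *: a) = c^* *: cstar a;
  cstarM : forall a b : A, cstar (cmul a b) = cmul (cstar b) (cstar a);
  cstarK : involutive cstar;
  normcM : forall a b : A, `|cmul a b| <= `|a| * `|b|;
  cstar_identity : forall a : A, `|cmul (cstar a) a| = `|a| ^+ 2
}.

#[short(type="cstarAlgType")]
HB.structure Definition CStarAlgebra (R : realType) :=
  {A of isCStarAlgebra R A & CompleteNormedModule R[i] A}.

Definition separable (T : topologicalType) : Prop :=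
  exists D : set T, countable D /\ dense D.

Section CStarTheory.
Variables (R : realType) (A : cstarAlgType R).
Implicit Types a b c : A.

Definition inner a b : A := cmul (cstar a) b.

Lemma innerDr a b c : inner a (b + c) = inner a b + inner a c.
Proof. exact: cmulDr. Qed.

Lemma innerDl a b c : inner (a + b) c = inner a c + inner b c.
Proof. by rewrite /inner cstarD cmulDl. Qed.

Lemma innerr0 a : inner a 0 = 0.
Proof. by apply: (addrI (inner a 0)); rewrite -innerDr !addr0. Qed.

Lemma inner0r a : inner 0 a = 0.
Proof. by apply: (addrI (inner 0 a)); rewrite -innerDl !addr0. Qed.

Lemma innerNr a b : inner a (- b) = - inner a b.
Proof. by apply: (addrI (inner a b)); rewrite -innerDr !subrr innerr0. Qed.

Lemma innerNl a b : inner (- a) b = - inner a b.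
Proof. by apply: (addrI (inner a b)); rewrite -innerDl !subrr inner0r. Qed.

Lemma inner_star a b : cstar (inner a b) = inner b a.
Proof. by rewrite /inner cstarM cstarK. Qed.

Lemma inner_eq0 a : inner a a = 0 -> a = 0.
Proof.
move=> a0; apply/eqP; rewrite -normr_eq0 -sqrf_eq0 -cstar_identity.
by rewrite -/(inner a a) a0 normr0.
Qed.

Lemma inner_injr b c : (forall a, inner a b = inner a c) -> b = c.
Proof.
move=> bc; apply/eqP; rewrite -subr_eq0; apply/eqP/inner_eq0.
by rewrite innerDr innerNr bc subrr.
Qed.

End CStarTheory.

(* M(A), realized as the algebra of adjointable maps of the Hilbert module A:
   a map with an adjoint is automatically bounded and A-linear, and [mop]
   determines [madj], see [mult_eq]. *)
Record multiplier (R : realType) (A : cstarAlgType R) := Multiplier {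
  mop :> A -> A;
  madj : A -> A;
  mopP : forall a b : A, inner (mop a) b = inner a (madj b)
}.

Section MultiplierAlgebra.
Variables (R : realType) (A : cstarAlgType R).
Local Notation M := (multiplier A).
Implicit Types x y z : M.

Lemma mult_eq x y : mop x =1 mop y -> x = y.
Proof.
case: x y => [f f' fP] [g g' gP] /= /funext fg; rewrite -{}fg in gP *.
have ff' : f' = g'.
  by apply/funext => b; apply: inner_injr => a; rewrite -fP gP.
by case: _ / ff' in gP *; congr Multiplier; exact: Prop_irrelevance.
Qed.

HB.instance Definition _ := gen_eqMixin M.
HB.instance Definition _ := gen_choiceMixin M.

Lemma madjP x (a b : A) : inner (madj x a) b = inner a (mop x b).
Proof. by rewrite -[LHS]inner_star -mopP inner_star. Qed.

Definition mstar x : M := Multiplier (madjP x).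

Lemma mopD x (a b : A) : mop x (a + b) = mop x a + mop x b.
Proof. by apply: inner_injr => c; rewrite -madjP !innerDr !madjP. Qed.

Lemma mzeroP (a b : A) : inner 0 b = inner a 0.
Proof. by rewrite innerr0 inner0r. Qed.

Lemma moneP (a b : A) : inner a b = inner a b.
Proof. by []. Qed.

Lemma maddP x y (a b : A) :
  inner (x a + y a) b = inner a (madj x b + madj y b).
Proof. by rewrite innerDl innerDr !mopP. Qed.

Lemma moppP x (a b : A) : inner (- x a) b = inner a (- madj x b).
Proof. by rewrite innerNl innerNr mopP. Qed.

Lemma mmulP x y (a b : A) : inner (x (y a)) b = inner a (madj y (madj x b)).
Proof. by rewrite !mopP. Qed.

Definition mzero : M := Multiplier mzeroP.
Definition mone : M := Multiplier moneP.
Definition madd x y : M := Multiplier (maddP x y).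
Definition mopp x : M := Multiplier (moppP x).
Definition mmul x y : M := Multiplier (mmulP x y).

Fact maddA : associative madd.
Proof. by move=> x y z; apply: mult_eq => a; exact: addrA. Qed.
Fact maddC : commutative madd.
Proof. by move=> x y; apply: mult_eq => a; exact: addrC. Qed.
Fact madd0 : left_id mzero madd.
Proof. by move=> x; apply: mult_eq => a; exact: add0r. Qed.
Fact maddN : left_inverse mzero mopp madd.
Proof. by move=> x; apply: mult_eq => a; exact: addNr. Qed.
Fact mmulA : associative mmul.
Proof. by move=> x y z; apply: mult_eq. Qed.
Fact mmul1x : left_id mone mmul.
Proof. by move=> x; apply: mult_eq. Qed.
Fact mmulx1 : right_id mone mmul.
Proof. by move=> x; apply: mult_eq. Qed.
Fact mmulDl : left_distributive mmul madd.
Proof. by move=> x y z; apply: mult_eq. Qed.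
Fact mmulDr : right_distributive mmul madd.
Proof. by move=> x y z; apply: mult_eq => a; exact: mopD. Qed.

HB.instance Definition _ := GRing.isZmodule.Build M maddA maddC madd0 maddN.
HB.instance Definition _ :=
  GRing.Zmodule_isPzRing.Build M mmulA mmul1x mmulx1 mmulDl mmulDr.

Definition mpos x : Prop := exists y, x = mstar y * y.

Definition is_msqrt x y : Prop := mpos y /\ y * y = x.

(* x^{1/2}; it is only meaningful for positive x, and is 0 if there is no
   positive square root. *)
Definition msqrt x : M := xget 0 [set y | is_msqrt x y].

End MultiplierAlgebra.

(* The values of [app] outside [dom] are irrelevant. *)
Record operator (R : realType) (A : cstarAlgType R) := Operator {
  dom : set A;
  app :> A -> A;
  dom0 : dom 0;
  dom_linear : forall (c : R[i]) (a b : A),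
    dom a -> dom b -> dom (c *: a + b);
  app_linear : forall (c : R[i]) (a b : A),
    dom a -> dom b -> app (c *: a + b) = c *: app a + app b
}.

Section Operators.
Variables (R : realType) (A : cstarAlgType R).
Implicit Types S T : operator A.

(* b is the value at a of the adjoint of T; it is unique if the domain of T is
   dense. *)
Definition is_adj T (a b : A) : Prop :=
  forall x : A, dom T x -> inner (T x) a = inner x b.

Definition adj_dom T : set A := [set a | exists b, is_adj T a b].

Definition adj T (a : A) : A := xget 0 [set b | is_adj T a b].

Definition graph T : set (A * A) := [set p | dom T p.1 /\ p.2 = T p.1].

Definition closed_op T : Prop := closed (graph T).

Definition closable T : Prop := forall x y y' : A,
  closure (graph T) (x, y) -> closure (graph T) (x, y') -> y = y'.

Definition semiregular T : Prop :=
  [/\ dense (dom T) /\ (forall x a : A, dom T x -> dom T (cmul x a)),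
      closable T & dense (adj_dom T)].

Definition dom_sq T : set A := [set x | dom T x /\ adj_dom T (T x)].

Definition one_plus_sq T (x : A) : A := x + adj T (T x).

Definition regular T : Prop :=
  [/\ semiregular T, closed_op T & dense (one_plus_sq T @` dom_sq T)].

(* c = (I + T^*T)^{-1} *)
Definition is_inv_one_plus_sq T (c : multiplier A) : Prop :=
  (forall a, dom_sq T (c a) /\ one_plus_sq T (c a) = a) /\
  (forall x, dom_sq T x -> c (one_plus_sq T x) = x).

(* z = T (I + T^*T)^{-1/2}, where r stands for (I + T^*T)^{-1/2} *)
Definition is_ztransform T (z : multiplier A) : Prop :=
  exists c r : multiplier A,
    [/\ is_inv_one_plus_sq T c, is_msqrt c r
      & forall a, dom T (r a) /\ T (r a) = z a].

Definition restriction S T : Prop :=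
  dom S `<=` dom T /\ (forall x, dom S x -> S x = T x).

End Operators.

(* Main.v *)
Require Import Defs.
From mathcomp Require Import all_boot all_order all_algebra.
From mathcomp Require Import complex.
From mathcomp Require Import all_classical all_reals all_analysis.
From mathcomp Require Import ring lra.

(** Write r and rS for (I + T^*T)^{-1/2} and (I + S^*S)^{-1/2}. One has
    r^2 = I - z^*z, the domain of T is r A, and T r a = z a; the same holds for
    S ([ztransformP]).

    If S is a restriction of T, then rS a lies in r A for every a, say
    rS a = r y; comparing S and T on this vector gives zS a = z y. Hence
    u := r rS + z^* zS maps a to (r^2 + z^*z) y = y, so that r u = rS and
    z u = zS. Consequently u^*u = u^*(r^2 + z^*z)u = rS^2 + zS^*zS = I, and
    u^*(I - z^*z)u = (r u)^*(r u) = rS^2 has the square root rS = r u.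
    Conversely, u^*u = I and zS = z u give u^*(I - z^*z)u = I - zS^*zS, so the
    equation between square roots says rS = r u, and S rS a = z u a = T r u a.

    Both directions identify [msqrt x] with a given positive square root of x,
    where positive means of the form w^*w. The substance of the proof is thus
    the uniqueness of positive square roots in M(A) ([mpos_sq_inj]), which rests
    on the theorem of Fukamiya, Kelley and Vaught, and Kaplansky: the elements
    w^*w form a cone that contains no line. Let h >= 0 be expressed by the norm:
    h = h^* and |t - h| <= t for some t ([mnneg]). This condition is stable
    under sums by the triangle inequality, and what has to be shown is that it
    holds for every a^*a ([mnneg_mstar_mul]). The proof uses no spectral theory.

    - If |h| < 1 and h = h^*, then 1 - h has a self-adjoint square root, found
      by iterating y |-> (h + y^2)/2 ([sqrt_one_sub]).
    - If k and l are commuting self-adjoint elements with k^2 + l^2 = K, then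
      k + i l is normal of norm sqrt K, whence |k^2 - l^2| <= K
      ([bnd_sq_sub]). So squares are nonnegative ([mnneg_sq]), and
      0 <= h <= K implies |h| <= K ([mnneg_bnd]).
    - From d - b^*b >= 0 follows d - bb^* >= 0, by comparing the growth of the
      powers of the two ([mnneg_swap]).
    - For x = a^*a and e > 0, let s = (x^2 + e^2)^{1/2}, m = s - x and
      b = a m s^{1/2}. Then 4 b^*b = e^4 - m^4, and b^*b + bb^* >= 0 forces
      m^4 <= 2 e^4. Thus x is within 2 e of s >= 0.

    Finally, if y^2 = r^2 with y, r positive, then d = y - r satisfies
    y d = - d r, so - d r d = d^2 y is a product of commuting nonnegative
    elements; hence d r d = 0, likewise d y d = 0, and d^3 = 0. *)

Set Implicit Arguments.
Unset Strict Implicit.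
Unset Printing Implicit Defensive.

Import Order.TTheory GRing.Theory Num.Theory.
Import numFieldNormedType.Exports.
Local Open Scope ring_scope.
Local Open Scope complex_scope.

(** * The real-valued norm *)

Section RealNorm.
Variables (R : realType) (A : cstarAlgType R).
Implicit Types (a b : A) (t : R).

(** The norm of [A] takes values in the complex numbers; [nrm] is the same norm
    with values in [R]. *)
Definition nrm a : R := complex.Re `|a|.

Lemma nrmE a : `|a| = (nrm a)%:C.
Proof.
rewrite /nrm; have := ger0_Im (normr_ge0 a).
by case: `|a| => x y /= ->.
Qed.

Lemma nrm_ge0 a : 0 <= nrm a.
Proof. by rewrite -ler0c -nrmE. Qed.

Lemma nrm_eq0 a : nrm a <= 0 -> a = 0.
Proof. by rewrite -lecR -nrmE normr_le0 => /eqP. Qed.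

Lemma nrmD a b : nrm (a + b) <= nrm a + nrm b.
Proof. by rewrite -lecR rmorphD /= -!nrmE ler_normD. Qed.

Lemma nrmN a : nrm (- a) = nrm a.
Proof. by rewrite /nrm normrN. Qed.

Lemma nrmZ (c : R[i]) a : nrm (c *: a) = complex.Re `|c| * nrm a.
Proof. by rewrite {1}/nrm normrZ nrmE normc_def /= mul0r subr0. Qed.

Lemma nrm_cmul a b : nrm (cmul a b) <= nrm a * nrm b.
Proof. by rewrite -lecR rmorphM /= -!nrmE normcM. Qed.

Lemma nrm_inner_self a : nrm (inner a a) = nrm a ^+ 2.
Proof.
by apply: complexI; rewrite rmorphXn /= -!nrmE cstar_identity.
Qed.

Lemma nrm_star_le a : nrm a <= nrm (cstar a).
Proof.
have [->|a0] := eqVneq (nrm a) 0; first exact: nrm_ge0.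
have a1 : 0 < nrm a by rewrite lt_neqAle nrm_ge0 eq_sym a0.
by rewrite -(ler_pM2r a1) -expr2 -nrm_inner_self nrm_cmul.
Qed.

Lemma nrm_star a : nrm (cstar a) = nrm a.
Proof. by apply/le_anti; rewrite nrm_star_le -{2}[a]cstarK nrm_star_le. Qed.

Lemma nrm_inner a b : nrm (inner a b) <= nrm a * nrm b.
Proof. by rewrite -[nrm a]nrm_star nrm_cmul. Qed.

Lemma geo_small (C q e : R) : 0 <= q < 1 -> 0 < e ->
  exists N, forall n, (N <= n)%N -> C * q ^+ n <= e.
Proof.
move=> /andP[q0 q1] e0.
have q1' : `|q| < 1 by rewrite ger0_norm.
have /cvgrPdist_le/(_ _ e0)[N _ HN] := @cvg_geometric R C q q1'.
exists N => n Nn.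
have := HN _ Nn; rewrite sub0r normrN; apply: le_trans; exact: ler_norm.
Qed.

(** Completeness of [A], for sequences that converge geometrically. *)
Lemma nrm_cauchy (u : nat -> A) (D q : R) : 0 <= q < 1 ->
  (forall n k, nrm (u (n + k)%N - u n) <= D * q ^+ n) ->
  exists l, forall n, nrm (l - u n) <= D * q ^+ n.
Proof.
move=> q01 uC.
have : cvg (u n @[n --> \oo])%classic.
  apply/cauchy_cvgP/cauchy_exP => e e0.
  have eE : e = (complex.Re e)%:C.
    by have := ger0_Im (ltW e0); case: (e) => x y /= ->.
  have r0 : 0 < complex.Re e by rewrite -ltcR -eE.
  have [N HN] := @geo_small D q (complex.Re e / 2) q01 (divr_gt0 r0 (ltr0n _ 2)).
  exists (u N); exists N => // n /= Nn.
  rewrite -ball_normE /= distrC nrmE eE ltcR.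
  have := uC N (n - N)%N; rewrite subnKC// => h.
  have := HN N (leqnn _); move: h; lra.
move=> /cvg_ex[l]; move=> /cvgrPdist_le H.
exists l => n; apply/ler_addgt0Pr => e e0.
have eC0 : 0 < e%:C by rewrite ltcR.
have [N _ HN] := H _ eC0.
have := HN (n + N)%N (leq_addl _ _); rewrite nrmE lecR => h.
have := uC n N; have := nrmD (l - u (n + N)%N) (u (n + N)%N - u n).
by rewrite subrKA; lra.
Qed.
End RealNorm.

(** * The *-algebra of multipliers and its operator norm *)

Section Multipliers.
Variables (R : realType) (A : cstarAlgType R).
Local Notation M := (multiplier A).
Implicit Types (a b : A) (t K : R) (c : R[i]) (x y h k : M).

Lemma innerZl c a b : inner (c *: a) b = c^* *: inner a b.
Proof. by rewrite /inner cstarZ cmulZl. Qed.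

Lemma innerZr c a b : inner a (c *: b) = c *: inner a b.
Proof. exact: cmulZr. Qed.

Lemma mopZ x c a : x (c *: a) = c *: x a.
Proof. by apply: inner_injr => b; rewrite -madjP !innerZr madjP. Qed.

Lemma mstarK x : mstar (mstar x) = x.
Proof. exact: mult_eq. Qed.

Lemma mstarD x y : mstar (x + y) = mstar x + mstar y.
Proof. exact: mult_eq. Qed.

Lemma mstarN x : mstar (- x) = - mstar x.
Proof. exact: mult_eq. Qed.

Lemma mstarB x y : mstar (x - y) = mstar x - mstar y.
Proof. exact: mult_eq. Qed.

Lemma mstarM x y : mstar (x * y) = mstar y * mstar x.
Proof. exact: mult_eq. Qed.

Lemma mstar1 : mstar (1 : M) = 1.
Proof. exact: mult_eq. Qed.

Lemma inner_mstar x a b : inner (x a) b = inner a (mstar x b).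
Proof. exact: mopP. Qed.

Lemma scP c a b : inner (c *: a) b = inner a (c^* *: b).
Proof. by rewrite innerZl innerZr. Qed.

(** The central element [c * 1] of M(A), for a complex scalar [c]. *)
Definition sc c : M := Multiplier (scP c).

Lemma scD c d : sc (c + d) = sc c + sc d.
Proof. by apply: mult_eq => a; exact: scalerDl. Qed.

Lemma scM c d : sc (c * d) = sc c * sc d.
Proof. by apply: mult_eq => a; rewrite /= scalerA. Qed.

Lemma sc1 : sc 1 = 1.
Proof. by apply: mult_eq => a; exact: scale1r. Qed.

Lemma scC c x : sc c * x = x * sc c.
Proof. by apply: mult_eq => a; rewrite /= mopZ. Qed.

Lemma mstar_sc c : mstar (sc c) = sc c^*.
Proof. exact: mult_eq. Qed.

Lemma sc_i_sq : sc 'i%C * sc 'i%C = -1.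
Proof.
by rewrite -scM -expr2 sqr_i; apply: mult_eq => a; rewrite /= scaleN1r.
Qed.

Lemma mstar_sc_i : mstar (sc 'i%C) = - sc 'i%C.
Proof.
rewrite mstar_sc; apply: mult_eq => a; rewrite /= -scaleNr; congr (_ *: _).
by apply/eqP; rewrite eq_complex /= oppr0 !eqxx.
Qed.

(** The real scalars of M(A). *)
Definition rsc t : M := sc t%:C.
Local Notation "t %:S" := (rsc t) (at level 1, left associativity, format "t %:S").

Lemma rscD s t : (s + t)%:S = s%:S + t%:S.
Proof. by rewrite /rsc rmorphD scD. Qed.

Lemma rscM s t : (s * t)%:S = s%:S * t%:S.
Proof. by rewrite /rsc rmorphM scM. Qed.

Lemma rsc1 : 1%:S = 1.
Proof. exact: sc1. Qed.

Lemma rsc0 : 0%:S = 0.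
Proof. by apply: (addrI 0%:S); rewrite -rscD !addr0. Qed.

Lemma rscN t : (- t)%:S = - t%:S.
Proof. by apply: (addrI t%:S); rewrite -rscD !subrr rsc0. Qed.

Lemma rscB s t : (s - t)%:S = s%:S - t%:S.
Proof. by rewrite rscD rscN. Qed.

Lemma rscMn t n : (t *+ n)%:S = t%:S *+ n.
Proof. by elim: n => [|n IH]; rewrite ?mulr0n ?rsc0 // !mulrS rscD IH. Qed.

Lemma rscX t n : (t ^+ n)%:S = t%:S ^+ n.
Proof. by elim: n => [|n IH]; rewrite ?expr0 ?rsc1 // !exprS rscM IH. Qed.

Lemma rscC t x : t%:S * x = x * t%:S.
Proof. exact: scC. Qed.

(** [x] is self-adjoint. *)
Definition sa x := mstar x = x.

Lemma sa_rsc t : sa t%:S.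
Proof. by rewrite /sa mstar_sc conjc_real. Qed.

Lemma sa1 : sa 1. Proof. exact: mstar1. Qed.

Lemma saD x y : sa x -> sa y -> sa (x + y).
Proof. by rewrite /sa mstarD => -> ->. Qed.

Lemma saN x : sa x -> sa (- x).
Proof. by rewrite /sa mstarN => ->. Qed.

Lemma saB x y : sa x -> sa y -> sa (x - y).
Proof. by move=> hx hy; apply: saD => //; apply: saN. Qed.

Lemma saM x y : sa x -> sa y -> GRing.comm x y -> sa (x * y).
Proof. by rewrite /sa mstarM => -> -> ->. Qed.

Lemma saZ t x : sa x -> sa (t%:S * x).
Proof. by move=> sx; apply: saM => //; [exact: sa_rsc|exact: rscC]. Qed.

Lemma saX x n : sa x -> sa (x ^+ n).
Proof.
move=> sx; elim: n => [|n IH]; first exact: sa1.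
by rewrite exprS; apply: saM => //; exact: commrX.
Qed.

Lemma sa_sq x : sa (mstar x * x).
Proof. by rewrite /sa mstarM mstarK. Qed.

(** The operator norm of [x] is at most [K]. That every multiplier is bounded is
    not used: a bound is a hypothesis wherever it is needed. *)
Definition bnd K x : Prop := 0 <= K /\ forall a, nrm (x a) <= K * nrm a.

Lemma bnd_le K K' x : K <= K' -> bnd K x -> bnd K' x.
Proof.
move=> KK' [K0 xK]; split; first exact: le_trans KK'.
move=> a; apply: le_trans (xK a) _; apply: ler_wpM2r => //; exact: nrm_ge0.
Qed.

Lemma bndD K K' x y : bnd K x -> bnd K' y -> bnd (K + K') (x + y).
Proof.
move=> [K0 xK] [K'0 yK']; split; first exact: addr_ge0.
move=> a; apply: le_trans (nrmD _ _) _.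
by rewrite mulrDl lerD.
Qed.

Lemma bndN K x : bnd K x -> bnd K (- x).
Proof. by move=> [K0 xK]; split=> // a; rewrite /= nrmN. Qed.

Lemma bndB K K' x y : bnd K x -> bnd K' y -> bnd (K + K') (x - y).
Proof. by move=> xK yK; apply: bndD => //; exact: bndN. Qed.

Lemma bndM K K' x y : bnd K x -> bnd K' y -> bnd (K * K') (x * y).
Proof.
move=> [K0 xK] [K'0 yK']; split; first exact: mulr_ge0.
move=> a; apply: le_trans (xK _) _.
by rewrite -mulrA ler_wpM2l.
Qed.

Lemma bnd_sc c : bnd (complex.Re `|c|) (sc c).
Proof.
split=> [|a]; last by rewrite nrmZ.
by rewrite -ler0c [_%:C](_ : _ = `|c|) // normc_def.
Qed.

Lemma bnd_rsc t : 0 <= t -> bnd t t%:S.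
Proof.
move=> t0; have := bnd_sc t%:C.
by rewrite ger0_norm ?ler0c.
Qed.

Lemma bnd1 : bnd 1 1.
Proof. by rewrite -rsc1; exact: bnd_rsc. Qed.

Lemma bnd0 : bnd 0 0.
Proof. by rewrite -rsc0; exact: bnd_rsc. Qed.

Lemma bndZ t K x : 0 <= t -> bnd K x -> bnd (t * K) (t%:S * x).
Proof. by move=> t0; apply: bndM; exact: bnd_rsc. Qed.

Lemma bndZV t K x : 0 < t -> bnd (t * K) (t%:S * x) -> bnd K x.
Proof.
move=> t0 /(@bndZ t^-1); rewrite invr_ge0 ltW // => /(_ isT).
by rewrite !mulrA -rscM mulVf ?gt_eqF// rsc1 !mul1r.
Qed.

Lemma bndX K x n : bnd K x -> bnd (K ^+ n) (x ^+ n).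
Proof.
move=> xK; elim: n => [|n IH]; first exact: bnd1.
by rewrite !exprS; exact: bndM.
Qed.

Lemma bnd_eq0 x : bnd 0 x -> x = 0.
Proof.
move=> [_ x0]; apply: mult_eq => a; apply: nrm_eq0.
by apply: le_trans (x0 a) _; rewrite mul0r.
Qed.

Lemma bnd_inf K x : 0 <= K ->
  (forall e, 0 < e -> e <= 1 -> bnd (K + e) x) -> bnd K x.
Proof.
move=> K0 xK; split=> // a; rewrite leNgt; apply/negP => lt.
set d := nrm (x a) - K * nrm a.
have d0 : 0 < d by rewrite subr_gt0.
have a0 := nrm_ge0 a.
pose e := Num.min 1 (d / 2 / (1 + nrm a)).
have p0 : 0 < 1 + nrm a by lra.
have e0 : 0 < e by rewrite lt_min ltr01 !divr_gt0.
have e1 : e <= 1 by rewrite ge_min lexx.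
have [_ /(_ a)] := xK e e0 e1.
have : e <= d / 2 / (1 + nrm a) by rewrite ge_min lexx orbT.
rewrite ler_pdivlMr // mulrDl -/d.
have := mulr_ge0 (ltW e0) a0.
rewrite /d in d0 *; nra.
Qed.

(** The involution is isometric. *)
Lemma bnd_star K x : bnd K x -> bnd K (mstar x).
Proof.
move=> [K0 xK]; split=> // a.
have [->|n0] := eqVneq (nrm (mstar x a)) 0; first by rewrite mulr_ge0 ?nrm_ge0.
have n1 : 0 < nrm (mstar x a) by rewrite lt_neqAle nrm_ge0 eq_sym n0.
rewrite -(ler_pM2r n1) -expr2 -nrm_inner_self inner_mstar mstarK.
apply: le_trans (nrm_inner _ _) _.
by rewrite [K * _]mulrC -mulrA ler_wpM2l ?nrm_ge0.
Qed.

(** The C*-identity for the operator norm, as an upper bound. *)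
Lemma bnd_cstar K x : 0 <= K -> bnd (K ^+ 2) (mstar x * x) -> bnd K x.
Proof.
move=> K0 [_ xK]; split=> // a.
rewrite -(ler_pXn2r (ltn0Sn 1)) ?nnegrE ?mulr_ge0 ?nrm_ge0//.
rewrite -nrm_inner_self inner_mstar; apply: le_trans (nrm_inner _ _) _.
rewrite exprMn [K ^+ 2 * _]mulrC [nrm a ^+ 2]expr2 -mulrA.
by apply: ler_wpM2l; rewrite ?nrm_ge0// mulrC; exact: xK.
Qed.

Lemma bnd_sa K h : sa h -> 0 <= K -> bnd (K ^+ 2) (h ^+ 2) -> bnd K h.
Proof. by move=> sh K0 hK; apply: bnd_cstar => //; rewrite sh. Qed.

Lemma bnd_sa_pow2 K h n : sa h -> 0 <= K ->
  bnd (K ^+ (2 ^ n)) (h ^+ (2 ^ n)) -> bnd K h.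
Proof.
move=> sh K0; elim: n => [|n IH]; first by rewrite !expr1.
rewrite expnSr !exprM => hK; apply: IH; apply: bnd_sa => //.
  exact: saX.
exact: exprn_ge0.
Qed.

(** A sequence of self-adjoint multipliers that converges geometrically in norm
    has a self-adjoint limit: the pointwise limit is its own adjoint. *)
Lemma mlim (u : nat -> M) C q : 0 <= q < 1 -> (forall n, sa (u n)) ->
    (forall n, bnd (C * q ^+ n) (u n.+1 - u n)) ->
  exists2 x, sa x & forall n, bnd (C / (1 - q) * q ^+ n) (x - u n).
Proof.
move=> q01 usa uC; have /andP[q0 q1] := q01.
have p0 : 0 < 1 - q by rewrite subr_gt0.
have C0 : 0 <= C by have [] := uC 0%N; rewrite expr0 mulr1.
set D := C / (1 - q).
have D0 : 0 <= D by rewrite divr_ge0 // ltW.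
have DC : D = C + D * q by rewrite /D; field; rewrite gt_eqF.
have uD (k n : nat) : bnd (D * q ^+ n) (u (n + k)%N - u n).
  elim: k n => [|k IH] n.
    by rewrite addn0 subrr; apply: bnd_le bnd0; rewrite mulr_ge0 ?exprn_ge0.
  rewrite -addSnnS -(subrKA (u n.+1)).
  apply: bnd_le (bndD (IH _) (uC n)).
  by rewrite [in leRHS]DC exprS mulrDl mulrA addrC.
have /choice[f fP] : forall a, exists l, forall n,
    nrm (l - u n a) <= D * nrm a * q ^+ n.
  move=> a; apply: nrm_cauchy => // n k.
  by have [_ /(_ a)] := uD k n; rewrite mulrAC.
have small r : (forall n, r <= D * q ^+ n) -> r <= 0.
  move=> rD; apply/ler_addgt0Pr => e e0; rewrite add0r.
  have [N HN] := geo_small D q01 e0.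
  exact: le_trans (rD N) (HN N (leqnn _)).
have fsa a b : inner (f a) b = inner a (f b).
  apply/eqP; rewrite -subr_eq0; apply/eqP/nrm_eq0/ler_addgt0Pr => e e0.
  rewrite add0r.
  have [N HN] := geo_small (2 * D * (nrm a * nrm b)) q01 e0.
  have := HN N (leqnn _); apply: le_trans.
  have -> : inner (f a) b - inner a (f b) =
     inner (f a - u N a) b - inner a (f b - u N b).
    rewrite innerDl innerDr innerNl innerNr inner_mstar usa opprB.
    by rewrite subrKA.
  apply: le_trans (nrmD _ _) _; rewrite nrmN.
  have := le_trans (nrm_inner _ _) (ler_wpM2r (nrm_ge0 b) (fP a N)).
  have := le_trans (nrm_inner _ _) (ler_wpM2l (nrm_ge0 a) (fP b N)).
  lra.
exists (Multiplier fsa); first exact: mult_eq.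
move=> n; split; first by rewrite mulr_ge0 ?exprn_ge0.
by move=> a; apply: le_trans (fP a n) _; rewrite mulrAC.
Qed.

End Multipliers.

(** * Square roots of strictly positive elements, and positivity by the norm *)

Section Positivity.
Variables (R : realType) (A : cstarAlgType R).
Local Notation M := (multiplier A).
Implicit Types (a b : A) (t K e : R) (c : R[i]) (x y h k l g : M).
Local Notation "t %:S" := (rsc A t) (at level 1, left associativity, format "t %:S").

Lemma bnd_small_eq0 x : (forall e, 0 < e -> bnd e x) -> x = 0.
Proof.
by move=> x0; apply: bnd_eq0; apply: bnd_inf => // e e0 _; rewrite add0r; exact: x0.
Qed.

Lemma comm_rsc t x : GRing.comm x t%:S.
Proof. by rewrite /GRing.comm rscC. Qed.

Lemma rsc2 x : 2%:S * x = x *+ 2.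
Proof. by rewrite (rscMn A 1 2) rsc1 mulr_natl. Qed.

(** The root is [1 - y], where [y] is the limit of the iteration of
    [y |-> (h + y^2)/2] from 0, a contraction on the ball of radius [q]. *)
Lemma sqrt_one_sub h (q : R) : sa h -> bnd q h -> q < 1 ->
  exists k, [/\ sa k, bnd q (1 - k), k ^+ 2 = 1 - h &
    forall g K, bnd K g -> GRing.comm g h -> GRing.comm g k].
Proof.
move=> sh hq q1; have q0 : 0 <= q by case: hq.
have q01 : 0 <= q < 1 by rewrite q0.
pose u := fix u n : M := if n is n'.+1 then 2^-1%:S * (h + u n' ^+ 2) else 0.
have usa n : sa (u n).
  elim: n => [|n IH] /=; first by rewrite -(rsc0 A); exact: sa_rsc.
  by apply: saZ; apply: saD => //; exact: saX.
have ubnd n : bnd q (u n).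
  elim: n => [|n IH] /=; first exact: bnd_le q0 (bnd0 A).
  have h2 : 0 <= 2^-1 :> R by rewrite invr_ge0.
  apply: bnd_le (bndZ h2 (bndD hq (bndX 2 IH))); nra.
have sqB x y C : bnd q x -> bnd q y -> bnd C (x - y) ->
    bnd (2 * q * C) (x ^+ 2 - y ^+ 2).
  move=> xq yq xyC.
  have -> : x ^+ 2 - y ^+ 2 = x * (x - y) + (x - y) * y.
    by rewrite mulrBr mulrBl subrKA !expr2.
  by apply: bnd_le (bndD (bndM xq xyC) (bndM xyC yq)); lra.
have ustep n : bnd (q * q ^+ n) (u n.+1 - u n).
  have h2 : 0 <= 2^-1 :> R by rewrite invr_ge0.
  elim: n => [|n IH].
    rewrite /= expr0n addr0 subr0; apply: bnd_le (bndZ h2 hq); lra.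
  have -> : u n.+2 - u n.+1 = 2^-1%:S * (u n.+1 ^+ 2 - u n ^+ 2).
    by rewrite [in LHS]/= -mulrBr opprD addrACA subrr add0r.
  by apply: bnd_le (bndZ h2 (sqB _ _ _ (ubnd _) (ubnd _) IH)); rewrite exprS; lra.
have [y sy yu] := mlim q01 usa ustep.
set D := q / (1 - q) in yu.
have yq : bnd q y.
  apply: bnd_inf => // e e0 _.
  have [N HN] := geo_small D q01 e0.
  rewrite -(subrK (u N) y) addrC; apply: bndD => //.
  exact: bnd_le (HN N (leqnn _)) (yu N).
have yE : h + y ^+ 2 = y *+ 2.
  apply/eqP; rewrite -subr_eq0; apply/eqP/bnd_small_eq0 => e e0.
  have [N HN] := geo_small (4 * D) q01 e0.
  apply: bnd_le (HN N (leqnn _)) _.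
  have -> : h + y ^+ 2 - y *+ 2 = (y ^+ 2 - u N ^+ 2) - 2%:S * (y - u N.+1).
    have -> : 2%:S * (y - u N.+1) = y *+ 2 - (h + u N ^+ 2).
      by rewrite mulrBr /= mulrA -rscM divff // rsc1 mul1r rsc2.
    by rewrite opprB addrA addrACA addNr addr0 [_ + h]addrC.
  apply: bnd_le (bndB (sqB _ _ _ yq (ubnd N) (yu N)) (bndZ (ler0n _ 2) (yu N.+1))).
  have Dq0 : 0 <= D * q ^+ N by case: (yu N).
  rewrite exprS; nra.
exists (1 - y); split.
- by apply: saB => //; exact: sa1.
- by rewrite subKr.
- rewrite expr2 mulrBl mul1r mulrBr mulr1 -expr2.
  have -> : y ^+ 2 = y *+ 2 - h by rewrite -yE addrC addKr.
  have -> : y - (y *+ 2 - h) = h - y.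
    by rewrite opprB addrCA mulr2n opprD [y + (_ - _)]addrA subrr add0r.
  by rewrite opprB subrKA.
- move=> g K gK gh.
  have gu n : GRing.comm g (u n).
    elim: n => [|n IH] /=; first exact: commr0.
    by apply: commrM; [exact: comm_rsc|apply: commrD => //; exact: commrX].
  apply: commrB; first exact: commr1.
  apply/eqP; rewrite -subr_eq0; apply/eqP/bnd_small_eq0 => e e0.
  have [N HN] := geo_small (2 * K * D) q01 e0.
  apply: bnd_le (HN N (leqnn _)) _.
  have -> : g * y - y * g = g * (y - u N) - (y - u N) * g.
    by rewrite mulrBr mulrBl (gu N) opprB addrA subrK.
  by apply: bnd_le (bndB (bndM gK (yu N)) (bndM (yu N) gK)); lra.
Qed.

(** Nonnegativity of a self-adjoint [h], expressed by the norm; the condition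
    for one [t] implies it for all larger ones. *)
Definition mnneg h : Prop := sa h /\ exists t, bnd t (t%:S - h).

(** Strict positivity: [h >= t (1 - q) > 0]. Such an [h] has a square root that is
    again strictly positive; a nonnegative [h] has to be shifted by a positive
    constant first. *)
Definition mspos h : Prop :=
  sa h /\ exists t q, [/\ 0 < t, q < 1 & bnd (t * q) (t%:S - h)].

Lemma mnneg_bounded h : mnneg h -> exists K, bnd K h.
Proof.
move=> [_ [t th]]; exists (t + t).
by rewrite -[h](subKr t%:S); apply: bndB => //; apply: bnd_rsc; case: th.
Qed.

Lemma mspos_nneg h : mspos h -> mnneg h.
Proof.
move=> [sh [t [q [t0 q1 th]]]]; split=> //; exists t; apply: bnd_le th.
by rewrite ler_piMr // ltW.
Qed.

Lemma mnneg_spos h e : mnneg h -> 0 < e -> mspos (h + e%:S).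
Proof.
move=> [sh [t th]] e0; have t0 : 0 <= t by case: th.
split; first by apply: saD => //; exact: sa_rsc.
exists (t + e), (t / (t + e)).
have te : 0 < t + e by lra.
split => //; first by rewrite ltr_pdivrMr // mul1r; lra.
by rewrite mulrC divfK ?gt_eqF // rscD opprD addrACA subrr addr0.
Qed.

Lemma mspos_sqrt h : mspos h -> exists k, [/\ mspos k, k ^+ 2 = h &
  forall g K, bnd K g -> GRing.comm g h -> GRing.comm g k].
Proof.
move=> [sh [t [q [t0 q1 th]]]].
have tV0 : 0 < t^-1 by rewrite invr_gt0.
have s1 : sa (t^-1%:S * (t%:S - h)).
  by apply: saZ; apply: saB => //; exact: sa_rsc.
have b1 : bnd q (t^-1%:S * (t%:S - h)).
  by apply: bnd_le (bndZ (ltW tV0) th); rewrite mulKf ?gt_eqF.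
have [k [sk kq k2 kc]] := sqrt_one_sub s1 b1 q1.
have st0 : 0 < Num.sqrt t by rewrite sqrtr_gt0.
exists ((Num.sqrt t)%:S * k); split.
- split; first exact: saZ.
  exists (Num.sqrt t), q; split => //.
  by rewrite -[X in X - _]mulr1 -mulrBr; apply: bndZ kq; exact: ltW.
- rewrite exprMn_comm; last by rewrite /GRing.comm rscC.
  rewrite k2 -rscX sqr_sqrtr ?ltW// [t^-1%:S * _]mulrBr.
  rewrite -rscM mulVf ?gt_eqF// rsc1 subKr.
  by rewrite mulrA -rscM divff ?gt_eqF// rsc1 mul1r.
- move=> g K gK gh; apply: commrM; first exact: comm_rsc.
  apply: (kc g K) => //; apply: commrM; first exact: comm_rsc.
  by apply: commrB => //; exact: comm_rsc.
Qed.

Lemma mnneg_mono h t t' : t <= t' -> bnd t (t%:S - h) -> bnd t' (t'%:S - h).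
Proof.
move=> tt' th.
have -> : t'%:S - h = (t%:S - h) + (t' - t)%:S by rewrite rscB [RHS]addrC subrKA.
have d0 : 0 <= t' - t by rewrite subr_ge0.
by apply: bnd_le (bndD th (bnd_rsc A d0)); rewrite subrKC.
Qed.

Lemma mnnegD h g : mnneg h -> mnneg g -> mnneg (h + g).
Proof.
move=> [sh [t th]] [sg [s sgs]]; split; first exact: saD.
by exists (t + s); rewrite rscD opprD addrACA; exact: bndD.
Qed.

Lemma mnnegZ t h : 0 <= t -> mnneg h -> mnneg (t%:S * h).
Proof.
move=> t0 [sh [s hs]]; split; first exact: saZ.
by exists (t * s); rewrite rscM -mulrBr; exact: bndZ.
Qed.

Lemma mnneg_subl h K : sa h -> bnd K h -> mnneg (K%:S - h).
Proof.
move=> sh hK; split; first by apply: saB => //; exact: sa_rsc.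
by exists K; rewrite subKr.
Qed.

(** With [w = k + i l] one has [w^* w = K], and twice [k^2 - l^2] is
    [w^2 + w^*^2]. *)
Lemma bnd_sq_sub k l K : sa k -> sa l -> GRing.comm k l -> 0 <= K ->
  k ^+ 2 + l ^+ 2 = K%:S -> bnd K (k ^+ 2 - l ^+ 2).
Proof.
move=> sk sl kl K0 kl2.
pose I : M := sc A 'i%C.
have II : I * I = -1 := sc_i_sq A.
have sI : mstar I = - I := mstar_sc_i A.
pose w := k + I * l.
have sw : mstar w = k - I * l.
  by rewrite mstarD mstarM sk sl sI mulrN scC.
have Il2 : (I * l) ^+ 2 = - l ^+ 2.
  by rewrite expr2 mulrA -(mulrA I l I) -scC (mulrA I I) II !mulN1r mulNr.
have kIl : k * (I * l) = (I * l) * k.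
  by rewrite mulrA -scC -!mulrA kl.
have w2 : mstar w * w = K%:S.
  by rewrite sw mulrBl !mulrDr -kIl -!expr2 Il2 -kl2 opprD opprK addrA addrK.
have wK : bnd (Num.sqrt K) w.
  by apply: bnd_cstar; rewrite ?sqrtr_ge0// w2 sqr_sqrtr//; exact: bnd_rsc.
have w2K := bndX 2 wK; have w2sK := bndX 2 (bnd_star wK).
rewrite sqr_sqrtr // in w2K w2sK.
have E : 2%:S * (k ^+ 2 - l ^+ 2) = w ^+ 2 + mstar w ^+ 2.
  rewrite sw /w -Il2; set J := I * l; rewrite rsc2 mulr2n.
  rewrite !expr2 mulrDl mulrBl !mulrBr !mulrDr opprB.
  rewrite [RHS]addrACA [k * k + k * J + _]addrACA subrr addr0.
  by rewrite [J * k + _ + _]addrC subrKA addrACA.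
by apply: (@bndZV _ _ 2) => //; rewrite E mulr_natl mulr2n; exact: bndD.
Qed.

(** If [0 <= h <= K], then [K - h] and [h] are, up to a small constant, squares
    of commuting elements. *)
Lemma mnneg_le_center h K : 0 <= K -> mnneg h -> mnneg (K%:S - h) ->
  bnd K (K%:S - 2%:S * h).
Proof.
move=> K0 nh nKh; apply: bnd_inf => // e e0 _.
have e20 : 0 < e / 2 by rewrite divr_gt0.
have [k [spk k2 kc]] := mspos_sqrt (mnneg_spos nh e20).
have [l [spl l2 lc]] := mspos_sqrt (mnneg_spos nKh e20).
have [L bl] := mnneg_bounded (mspos_nneg spl).
have [L' bh] := mnneg_bounded (mspos_nneg (mnneg_spos nh e20)).
have kl : GRing.comm l k.
  apply: (kc l L) => //; apply/commr_sym; apply: (lc _ L') => //.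
  apply: commrD; last exact: comm_rsc.
  apply: commrB; first exact: comm_rsc.
  by apply/commr_sym; apply: commrD; [|exact: comm_rsc].
have E : l ^+ 2 - k ^+ 2 = K%:S - 2%:S * h.
  rewrite l2 k2 opprD addrACA subrr addr0 rsc2.
  by rewrite mulr2n opprD addrA.
rewrite -E; apply: bnd_sq_sub => //; [by case: spl|by case: spk|lra|].
rewrite l2 k2 addrACA subrK -rscD -rscD.
by congr (_ %:S); field.
Qed.

Lemma mnneg_bnd h K : 0 <= K -> mnneg h -> mnneg (K%:S - h) -> bnd K h.
Proof.
move=> K0 nh nKh; apply: (@bndZV _ _ 2) => //.
rewrite -(subKr K%:S (_ * h)); apply: bnd_le (bndB (bnd_rsc A K0) _); last first.
  exact: mnneg_le_center.
by lra.
Qed.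

Lemma mnneg_bnd_sub h K : mnneg h -> bnd K h -> bnd K (K%:S - h).
Proof.
move=> nh hK; have K0 : 0 <= K by case: hK.
have nK : mnneg (K%:S - h) by apply: mnneg_subl => //; case: nh.
by apply: mnneg_bnd => //; rewrite subKr.
Qed.

Lemma mnneg_sq h K : sa h -> bnd K h -> mnneg (h ^+ 2).
Proof.
move=> sh hK; have K0 : 0 <= K by case: hK.
have K1 : 0 < K + 1 by lra.
pose h' := (K + 1)^-1%:S * h.
have sh' : sa h' by exact: saZ.
have q1 : (K + 1)^-1 * K < 1 by rewrite mulrC ltr_pdivrMr // mul1r; lra.
have q0 : 0 <= (K + 1)^-1 * K by rewrite mulr_ge0 // invr_ge0 ltW.
have bh' : bnd ((K + 1)^-1 * K) h' by apply: bndZ hK; rewrite invr_ge0 ltW.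
have q21 : ((K + 1)^-1 * K) ^+ 2 < 1 by rewrite expr_lt1.
have [l [sl _ l2 lc]] := sqrt_one_sub (saX 2 sh') (bndX 2 bh') q21.
have h'l : GRing.comm h' l by apply: lc bh' _; exact: commrX.
have := bnd_sq_sub sl sh' (commr_sym h'l) (@ler01 R).
rewrite l2 subrK rsc1 => /(_ erefl) b1.
have : mnneg (2%:S * h' ^+ 2).
  split; first by apply: saZ; exact: saX.
  exists 1; rewrite rsc1 rsc2 mulr2n opprD addrA.
  exact: b1.
have Kn0 : 0 <= (K + 1) ^+ 2 / 2 by rewrite divr_ge0 // exprn_ge0 // ltW.
move=> /(mnnegZ Kn0).
rewrite /h' exprMn_comm; last by rewrite /GRing.comm rscC.
rewrite -rscX !mulrA -!rscM divfK// -exprMn divff ?gt_eqF// expr1n rsc1 mul1r.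
by [].
Qed.

(** The spectral radius formula for self-adjoint elements, as an upper bound. *)
Lemma bnd_sa_power h t (C : R) : sa h -> 0 <= t ->
  (forall n, bnd (C * t ^+ n) (h ^+ n)) -> bnd t h.
Proof.
move=> sh t0 hC; apply: bnd_inf => // e e0 _.
have te : 0 < t + e by lra.
have q01 : 0 <= t / (t + e) < 1.
  by rewrite divr_ge0 ?ltr_pdivrMr // ?(ltW te)// mul1r; lra.
have [N HN] := geo_small C q01 (@ltr01 R).
apply: (@bnd_sa_pow2 _ _ _ _ N) => //; first exact: ltW.
apply: bnd_le (hC _).
have := HN _ (ltnW (ltn_expl N (ltnSn 1))).
by rewrite expr_div_n mulrA ler_pdivrMr ?exprn_gt0 // mul1r.
Qed.

(** A substitute for the equality of the nonzero spectra of [b^* b] and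
    [b b^*]: with [X = tau + b b^*] and [Y = tau + b^* b] one has [b^* X = Y b^*],
    so the powers of [X] are controlled by those of [Y]. Strictness of [0 < d]
    keeps the geometric sums bounded. *)
Lemma mnneg_swap (b : M) (d B : R) : bnd B b -> 0 < d ->
  mnneg (d%:S - mstar b * b) -> mnneg (d%:S - b * mstar b).
Proof.
move=> bB d0 [_ [t0 ht0]].
have B0 : 0 <= B by case: bB.
set t := Num.max t0 d.
have t0t : t0 <= t by rewrite le_max lexx.
have {ht0}ht := mnneg_mono t0t ht0.
have dt : d <= t by rewrite le_max lexx orbT.
have t00 : 0 < t by lra.
split; first by apply: saB; [exact: sa_rsc|rewrite -{1}(mstarK b); exact: sa_sq].
pose tau := t - d.
have tau0 : 0 <= tau by rewrite subr_ge0.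
have tauE z : t%:S - (d%:S - z) = tau%:S + z.
  by rewrite /tau rscB opprB addrCA addrC.
exists t; rewrite tauE; rewrite tauE in ht.
set X := _ + _; set Y := _ + _ in ht.
have XY : mstar b * X = Y * mstar b.
  by rewrite /X /Y mulrDr mulrDl -rscC !mulrA.
(* S is the sum of tau^(n-1-i) Y^i over i < n; its bound is the sum of
   tau^(n-1-i) t^i, where t - tau = d *)
have key n : exists2 S, bnd ((t ^+ n - tau ^+ n) / d) S &
    X ^+ n = (tau ^+ n)%:S + b * S * mstar b.
  elim: n => [|n [S bS XS]].
    exists 0; first by rewrite subrr mul0r; exact: bnd0.
    by rewrite !expr0 rsc1 mulr0 mul0r addr0.
  exists ((tau ^+ n)%:S + S * Y).
    apply: bnd_le (bndD (bnd_rsc A (exprn_ge0 _ tau0)) (bndM bS ht)).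
    rewrite !exprS le_eqVlt; apply/orP; left; apply/eqP.
    move: (t ^+ n) (tau ^+ n) => p r; rewrite /tau; field.
    by rewrite gt_eqF.
  rewrite exprSr XS mulrDl -mulrA -mulrA XY {1}/X mulrDr -rscM -exprSr.
  rewrite -addrA; congr (_ + _).
  by rewrite mulrDr mulrDl !mulrA -rscC.
apply: (@bnd_sa_power _ _ (1 + B ^+ 2 / d)).
- by apply: saD; [exact: sa_rsc|rewrite -{1}(mstarK b); exact: sa_sq].
- exact: ltW.
move=> n; have [S bS ->] := key n.
apply: bnd_le (bndD (bnd_rsc A (exprn_ge0 n tau0))
  (bndM (bndM bB bS) (bnd_star bB))).
have tt : tau <= t by rewrite /tau; lra.
have le1 : tau ^+ n <= t ^+ n by apply: lerXn2r tt; rewrite nnegrE // ltW.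
have p0 : 0 <= tau ^+ n by rewrite exprn_ge0.
have p1 : 0 <= B ^+ 2 / d by rewrite divr_ge0 ?exprn_ge0 // ltW.
move: le1 p0 p1; rewrite expr2; move: (t ^+ n) (tau ^+ n) => p r le1 p0 p1.
have -> : B * ((p - r) / d) * B = B * B / d * (p - r).
  by field; rewrite gt_eqF.
nra.
Qed.

End Positivity.

(** * Nonnegativity of a^*a and uniqueness of positive square roots *)

Section SquareRoots.
Variables (R : realType) (A : cstarAlgType R).
Local Notation M := (multiplier A).
Implicit Types (t K e B : R) (c : R[i]) (a b x y h k l g d r : M).
Local Notation "t %:S" := (rsc A t) (at level 1, left associativity, format "t %:S").

Lemma mnnegZV t h : 0 < t -> mnneg (t%:S * h) -> mnneg h.
Proof.
move=> t0 /(@mnnegZ _ _ t^-1); rewrite invr_ge0 ltW // => /(_ isT).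
by rewrite mulrA -rscM mulVf ?gt_eqF// rsc1 mul1r.
Qed.

(** If [b = h + i k] with [h], [k] self-adjoint, then
    [b^* b + b b^* = 2 (h^2 + k^2)]. *)
Lemma mnneg_cross b B : bnd B b -> mnneg (mstar b * b + b * mstar b).
Proof.
move=> bB; have bsB := bnd_star bB.
pose I : M := sc A 'i%C.
have II : I * I = -1 := sc_i_sq A.
have sI : mstar I = - I := mstar_sc_i A.
have s1 : sa (b + mstar b) by rewrite /sa mstarD mstarK addrC.
have s2 : sa (I * (b - mstar b)).
  by rewrite /sa mstarM sI mstarB mstarK mulrN -scC -mulrN opprB.
apply: (@mnnegZV 2) => //.
have -> : 2%:S * (mstar b * b + b * mstar b) =
    (b + mstar b) ^+ 2 + (I * (b - mstar b)) ^+ 2.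
  rewrite rsc2 [_ ^+ 2 in RHS]expr2 [(I * _) ^+ 2]expr2.
  rewrite [I * _ * _]mulrA -[I * _ * I]mulrA -[(b - _) * I]scC [I * (I * _)]mulrA II.
  rewrite mulN1r mulNr.
  set s := mstar b; rewrite mulrDl mulrBl !mulrBr !mulrDr !opprB.
  rewrite [b * b + b * s]addrC [s * b - _ + _]addrC [RHS]addrACA.
  rewrite [b * s + _ + _]addrACA [s * b + _ + _]addrACA !subrr !addr0.
  by rewrite mulr2n [RHS]addrC [RHS]addrACA.
apply: mnnegD.
  exact: mnneg_sq s1 (bndD bB bsB).
exact: mnneg_sq s2 (bndM (bnd_sc A 'i%C) (bndB bB bsB)).
Qed.

(** Compare [x = a^* a] with [s = (x^2 + ep^2)^{1/2}], a smooth substitute for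
    its absolute value; [m = s - x] is then small because [x] has no negative
    part. *)
Theorem mnneg_mstar_mul a B : bnd B a -> mnneg (mstar a * a).
Proof.
move=> aB; have B0 : 0 <= B by case: aB.
set x := mstar a * a; set X := B ^+ 2.
have sx : sa x by exact: sa_sq.
have bx : bnd X x by exact: bndM (bnd_star aB) aB.
have X0 : 0 <= X by case: bx.
split=> //; exists (X + 1); apply: bnd_inf => [|e e0 e1]; first by lra.
pose ep := e / 2.
have ep0 : 0 < ep by rewrite divr_gt0.
have ep20 : 0 < ep ^+ 2 by rewrite exprn_gt0.
have [s [sps s2 sc]] := mspos_sqrt (mnneg_spos (mnneg_sq sx bx) ep20).
have [q [spq q2 qc]] := mspos_sqrt sps.
have ss : sa s by case: sps.
have sq : sa q by case: spq.
have [Ks bs] := mnneg_bounded (mspos_nneg sps).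
have [Kq bq] := mnneg_bounded (mspos_nneg spq).
have xs : GRing.comm x s.
  by apply: sc bx _; apply: commrD; [exact: commrX|exact: comm_rsc].
have xq : GRing.comm x q by exact: qc bx xs.
have sq' : GRing.comm s q by rewrite -q2; apply/commr_sym; exact: commrX.
have sm' : sa (s - x) by exact: saB.
have bm' := bndB bs bx.
have xE : mstar a * a = x by [].
have mE : s - x = s - x by [].
have pE : s + x = s + x by [].
move: {2 4}(s - x) mE sm' bm' => m mE; rewrite mE => sm bm.
move: {2}(s + x) pE => p pE.
have xm : GRing.comm x m by rewrite -mE; apply: commrB.
have mq : GRing.comm m q.
  by rewrite -mE; apply/commr_sym; apply: commrB; apply: commr_sym.
have pm : GRing.comm p m.
  rewrite -mE -pE; apply: commrB; apply/commr_sym; apply: commrD => //.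
have pmE : p * m = (ep ^+ 2)%:S.
  rewrite -mE -pE mulrDl !mulrBr xs addrA subrK -expr2 s2 -expr2.
  by rewrite addrC addKr.
have e1' : 2%:S * x = p - m.
  by rewrite rsc2 -pE -mE opprB addrC addrA subrK mulr2n.
have e2' : 2%:S * s = p + m.
  by rewrite rsc2 -pE -mE addrACA subrr addr0 mulr2n.
clearbody x.
(* multiplying a by m cuts x down to its negative part; the factor q = s^{1/2}
   turns b^* b into a polynomial in m *)
pose b := a * m * q.
have bb : bnd (B * (Ks + X) * Kq) b by exact: bndM (bndM aB bm) bq.
have bE : mstar b * b = x * s * m ^+ 2.
  rewrite /b !mstarM sq sm -q2.
  have -> : q * (m * mstar a) * (a * m * q) = q * m * x * m * q.
    by rewrite -xE !mulrA.
  rewrite -!mulrA mq [m * (x * _)]mulrA -xm -!mulrA [m * (q * m)]mulrA mq.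
  by rewrite mulrA -xq !expr2 !mulrA.
have pm2 : (p - m) * (p + m) = p ^+ 2 - m ^+ 2.
  by rewrite mulrBl !mulrDr -pm opprD addrA addrK -!expr2.
have b4 : 4%:S * (mstar b * b) = (ep ^+ 4)%:S - m ^+ 4.
  have -> : 4%:S * (mstar b * b) = (2%:S * x) * (2%:S * s) * m ^+ 2.
    rewrite bE (_ : 4 = 2 * 2 :> R); last by ring.
    by rewrite rscM !mulrA -[2%:S * x * 2%:S]mulrA -(rscC 2 x) !mulrA.
  rewrite e1' e2' pm2 mulrBl -exprMn_comm // pmE -rscX -exprM.
  by rewrite -exprD.
pose d := ep ^+ 4 / 4.
have d0 : 0 < d by rewrite divr_gt0 // exprn_gt0.
have m4E : mstar b * b = d%:S - 4^-1%:S * m ^+ 4.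
  have : 4^-1%:S * (4%:S * (mstar b * b)) = 4^-1%:S * ((ep ^+ 4)%:S - m ^+ 4).
    by rewrite b4.
  rewrite mulrA -rscM mulVf ?pnatr_eq0// rsc1 mul1r => ->.
  by rewrite mulrBr -rscM /d mulrC.
have np4 : mnneg (4^-1%:S * m ^+ 4).
  apply: mnnegZ; first by rewrite invr_ge0.
  by rewrite (exprM m 2 2); exact: mnneg_sq (saX 2 sm) (bndX 2 bm).
have np1 : mnneg (d%:S - b * mstar b).
  by apply: mnneg_swap bb d0 _; rewrite m4E subKr.
have np2 : mnneg ((d + d)%:S - 4^-1%:S * m ^+ 4).
  have -> : (d + d)%:S - 4^-1%:S * m ^+ 4 =
      mstar b * b + b * mstar b + (d%:S - b * mstar b).
    by rewrite [d%:S - b * _]addrC addrA addrK m4E rscD addrAC.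
  exact: mnnegD (mnneg_cross bb) np1.
have dd0 : 0 <= d + d by lra.
have b5 := mnneg_bnd dd0 np4 np2.
have m2 : bnd (2 * ep) m.
  apply: (@bnd_sa_pow2 _ _ _ _ 2) => //; first by lra.
  apply: (@bndZV _ _ 4^-1); first by rewrite invr_gt0.
  apply: bnd_le b5; rewrite /d.
  rewrite -[(2 ^ 2)%N]/4%N (_ : (2 * ep) ^+ 4 = 16 * ep ^+ 4); last by ring.
  have := exprn_gt0 4 ep0; lra.
have bs' : bnd (X + 1) s.
  apply: bnd_sa => //; first by lra.
  rewrite s2; apply: bnd_le (bndD (bndX 2 bx) (bnd_rsc A (ltW ep20))).
  have : ep <= 1 by rewrite /ep; lra.
  move: ep0; nra.
have -> : (X + 1)%:S - x = (X + 1)%:S - s + m by rewrite -mE subrKA.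
apply: bnd_le (bndD (mnneg_bnd_sub (mspos_nneg sps) bs') m2).
by rewrite /ep; lra.
Qed.

Lemma mpos_mnneg y K : mpos y -> bnd K y -> mnneg y.
Proof.
move=> [w yw] yK; have K0 : 0 <= K by case: yK.
rewrite yw; apply: (@mnneg_mstar_mul _ (Num.sqrt K)).
by apply: bnd_cstar; rewrite ?sqrtr_ge0// sqr_sqrtr // -yw.
Qed.

Lemma mpos_sa y : mpos y -> sa y.
Proof. by move=> [w ->]; exact: sa_sq. Qed.

Lemma mpos_conj y d : sa d -> mpos y -> mpos (d * y * d).
Proof. by move=> sd [w ->]; exists (w * d); rewrite mstarM sd !mulrA. Qed.

(** [y d = - d r] makes [y] commute with [d^2], with [d^2 y = - d r d]. So
    [- d r d] is nonnegative, up to the approximation of [y] by [y + eta], and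
    [d r d] is nonnegative by assumption. *)
Lemma anticomm_eq0 d y r D : sa d -> sa r -> bnd D d -> mnneg y ->
  mnneg (d * r * d) -> y * d = - (d * r) -> d * r * d = 0.
Proof.
move=> sd sr dD ny nN yd; have sy : sa y by case: ny.
set N := d * r * d in nN *.
have yd2 : y * d ^+ 2 = - N by rewrite expr2 mulrA yd mulNr.
have d2y : d ^+ 2 * y = - N.
  have := congr1 (@mstar R A) yd2.
  by rewrite mstarM mstarN (saX 2 sd) sy; have [-> _] := nN.
have D0 : 0 <= D ^+ 2 by rewrite exprn_ge0 //; case: dD.
apply: bnd_small_eq0 => e e0.
pose eta := e / (D ^+ 2 + 1).
have D1 : 0 < D ^+ 2 + 1 by lra.
have eta0 : 0 < eta by rewrite divr_gt0.
have [k [spk k2 kc]] := mspos_sqrt (mnneg_spos ny eta0).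
have [K bk] := mnneg_bounded (mspos_nneg spk).
have sk : sa k by case: spk.
have dk : GRing.comm (d ^+ 2) k.
  apply: kc (bndX 2 dD) _; apply: commrD; last exact: comm_rsc.
  by rewrite /GRing.comm d2y yd2.
have n1 : mnneg (eta%:S * d ^+ 2 - N).
  have -> : eta%:S * d ^+ 2 - N = mstar (d * k) * (d * k).
    rewrite mstarM sk sd -mulrA (mulrA d) -expr2 dk mulrA -expr2 k2.
    by rewrite mulrDl yd2 addrC.
  exact: mnneg_mstar_mul (bndM dD bk).
have n2 : mnneg ((eta * D ^+ 2)%:S - N).
  have -> : (eta * D ^+ 2)%:S - N =
      eta%:S * ((D ^+ 2)%:S - d ^+ 2) + (eta%:S * d ^+ 2 - N).
    by rewrite mulrBr -rscM subrKA.
  apply: mnnegD n1; apply: mnnegZ (ltW eta0) _; apply: mnneg_subl; first exact: saX.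
  exact: bndX.
apply: bnd_le (mnneg_bnd _ nN n2); last by rewrite mulr_ge0 // ltW.
rewrite /eta mulrAC ler_pdivrMr // ler_pM2l //; lra.
Qed.

(** Uniqueness of positive square roots. *)
Lemma mpos_sq_inj y r K K' : bnd K y -> bnd K' r -> mpos y -> mpos r ->
  y * y = r * r -> y = r.
Proof.
move=> yK rK py pr yr; apply/eqP; rewrite -subr_eq0; apply/eqP; set d := y - r.
have sy := mpos_sa py; have sr := mpos_sa pr.
have sd : sa d by exact: saB.
have dD := bndB yK rK; rewrite -/d in dD.
have yd : y * d = - (d * r).
  by rewrite /d mulrBr mulrBl opprB yr.
have rd : r * d = - (d * y).
  by rewrite /d mulrBr mulrBl opprB yr.
have pconj z : mpos z -> (exists K, bnd K z) -> mnneg (d * z * d).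
  move=> pz [Kz bz]; apply: mpos_mnneg (mpos_conj sd pz) (bndM (bndM dD bz) dD).
have z1 : d * r * d = 0.
  apply: anticomm_eq0 yd => //; [exact: dD|exact: mpos_mnneg py yK|].
  by apply: pconj => //; exists K'.
have z2 : d * y * d = 0.
  apply: anticomm_eq0 rd => //; [exact: dD|exact: mpos_mnneg pr rK|].
  by apply: pconj => //; exists K.
have d3 : d ^+ 3 = 0.
  have -> : d ^+ 3 = d * y * d - d * r * d.
    by rewrite -mulrBl -mulrBr -/d !exprS expr0 mulr1 mulrA.
  by rewrite z1 z2 subrr.
apply: bnd_eq0; apply: (@bnd_sa_pow2 _ _ _ _ 2) => //.
rewrite -[(2 ^ 2)%N]/4%N (exprS d 3) d3 mulr0 expr0n; exact: bnd0.
Qed.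

Lemma msqrt_unique x y K : bnd K x -> is_msqrt x y -> msqrt x = y.
Proof.
move=> xK [py yx]; have K0 : 0 <= K by case: xK.
have bd z : is_msqrt x z -> bnd (Num.sqrt K) z.
  move=> [pz zx]; apply: bnd_sa; [exact: mpos_sa|exact: sqrtr_ge0|].
  by rewrite sqr_sqrtr // expr2 zx.
have [pz zx] : is_msqrt x (msqrt x).
  by rewrite /msqrt; case: xgetP => [z -> //|/(_ y)]; case; split.
by apply: (mpos_sq_inj (bd _ _) (bd _ _)) => //; rewrite ?yx.
Qed.

End SquareRoots.

(** * Elements of A as multipliers *)

Section LeftMultiplication.
Variables (R : realType) (A : cstarAlgType R).
Implicit Types (p q a b : A).

Lemma lmulP p a b : inner (cmul p a) b = inner a (cmul (cstar p) b).
Proof. by rewrite /inner cstarM cmulA. Qed.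

(** Left multiplication by [p], the canonical image of [p] in M(A). *)
Definition lmul p : multiplier A := Multiplier (lmulP p).

Lemma bnd_lmul p : bnd (nrm p) (lmul p).
Proof. by split; [exact: nrm_ge0|exact: nrm_cmul]. Qed.

Lemma lmul_inner p : lmul (inner p p) = mstar (lmul p) * lmul p.
Proof. by apply: mult_eq => a; rewrite /= /inner cmulA. Qed.

Lemma bnd_lmul_le K p : bnd K (lmul p) -> nrm p <= K.
Proof.
move=> [K0 /(_ (cstar p))]; rewrite nrm_star /= => h.
have := nrm_inner_self (cstar p); rewrite /inner cstarK nrm_star => E.
rewrite {}E in h.
have [->//|p0] := eqVneq (nrm p) 0.
have p1 : 0 < nrm p by rewrite lt_neqAle nrm_ge0 eq_sym p0.
by rewrite -(ler_pM2r p1) -expr2.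
Qed.

(** Monotonicity of the norm on the positive cone, transferred from M(A). *)
Lemma nrm_innerD p q : nrm p ^+ 2 <= nrm (inner p p + inner q q).
Proof.
set g := _ + _; set K := nrm g.
have K0 : 0 <= K by exact: nrm_ge0.
have gE : lmul g = lmul (inner p p) + lmul (inner q q).
  by apply: mult_eq => a; rewrite /= cmulDl.
rewrite !lmul_inner in gE.
have ng : mnneg (rsc A K - lmul g).
  apply: mnneg_subl (bnd_lmul g); rewrite gE; apply: saD; exact: sa_sq.
have np1 : mnneg (rsc A K - mstar (lmul p) * lmul p).
  have -> : rsc A K - mstar (lmul p) * lmul p =
      rsc A K - lmul g + mstar (lmul q) * lmul q.
    by rewrite gE opprD addrA subrK.
  exact: mnnegD ng (mnneg_mstar_mul (bnd_lmul q)).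
have := mnneg_bnd K0 (mnneg_mstar_mul (bnd_lmul p)) np1.
rewrite -{1}(sqr_sqrtr K0) => /(bnd_cstar (sqrtr_ge0 _))/bnd_lmul_le h.
by rewrite -(sqr_sqrtr K0) lerXn2r ?nnegrE ?sqrtr_ge0 ?nrm_ge0.
Qed.

Lemma dense_inner_eq0 (D : set A) b : dense D ->
  (forall x, D x -> inner x b = 0) -> b = 0.
Proof.
move=> dD Db; apply: nrm_eq0; apply/ler_addgt0Pr => e e0; rewrite add0r.
have eC0 : 0 < e%:C by rewrite ltcR.
have [|x [/= bx Dx]] := dD (ball b e%:C) _ (ball_open _ _).
  by exists b; exact: ballxx.
rewrite -ball_normE /= nrmE ltcR in bx.
have E : inner b b = inner (b - x) b by rewrite innerDl innerNl (Db x Dx) subr0.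
have := nrm_inner (b - x) b; rewrite -E nrm_inner_self => h.
have [->|b0] := eqVneq (nrm b) 0; first exact: ltW.
have b1 : 0 < nrm b by rewrite lt_neqAle nrm_ge0 eq_sym b0.
by apply: ltW; apply: le_lt_trans bx; rewrite -(ler_pM2r b1) -expr2.
Qed.

End LeftMultiplication.

(** * The z-transform *)

Section ZTransform.
Variables (R : realType) (A : cstarAlgType R).
Implicit Types (T : operator A) (z c r : multiplier A) (a b : A).

Lemma adjP T a : adj_dom T a -> is_adj T a (adj T a).
Proof. by rewrite /adj => -[b Tb]; case: xgetP => [d -> //|/(_ b)]; case. Qed.

Lemma inv_one_plus_sqP T c a b : is_inv_one_plus_sq T c -> dom T a ->
  inner (T a) (T (c b)) = inner a (b - c b).
Proof.
move=> [/(_ b)[[_ Tcb] cb] _] Ta; rewrite (adjP Tcb Ta) -{2}cb.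
by rewrite /one_plus_sq addrAC subrr add0r.
Qed.

(** From [<c a, a> = <c a, c a> + <T c a, T c a>]. *)
Lemma inv_one_plus_sq_bnd T c : is_inv_one_plus_sq T c -> bnd 1 c.
Proof.
move=> cP; split=> // a; rewrite mul1r.
have [[Tc _] _] := cP.1 a.
have := nrm_innerD (c a) (T (c a)).
rewrite (inv_one_plus_sqP _ cP Tc) -innerDr subrKC => h.
have {}h := le_trans h (nrm_inner _ _).
have [->|n0] := eqVneq (nrm (c a)) 0; first exact: nrm_ge0.
have n1 : 0 < nrm (c a) by rewrite lt_neqAle nrm_ge0 eq_sym n0.
by rewrite -(ler_pM2l n1) -expr2.
Qed.

(** All that is used of the z-transform: the operator [T] is determined by
    [z] through [r = (1 - z^* z)^{1/2}], whose range is the domain of [T]. *)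
Lemma ztransformP T z : dense (dom T) -> is_ztransform T z -> exists r,
  [/\ bnd 1 (1 - mstar z * z), is_msqrt (1 - mstar z * z) r,
      forall x, dom T x <-> exists a, x = r a &
      forall a, T (r a) = z a].
Proof.
move=> dT [c [r [cP [pr rc] zP]]].
have sr : mstar r = r := mpos_sa pr.
have rr a : r (r a) = c a by rewrite -rc.
have sc : mstar c = c by rewrite -rc mstarM sr.
have domP x : dom T x <-> exists a, x = r a.
  split=> [Tx|[a ->]]; last by have [] := zP a.
  (* r^2 x = c x, and r z^* T x = x - c x since z r = T c *)
  exists (r x + mstar z (T x)); rewrite mopD rr.
  have -> : r (mstar z (T x)) = x - c x.
    apply: inner_injr => a.
    rewrite -[in LHS]sr -inner_mstar -inner_mstar.
    have [_ <-] := zP (r a); rewrite rr.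
    rewrite -inner_star (inv_one_plus_sqP _ cP Tx) inner_star.
    by rewrite innerDl innerNl innerDr innerNr inner_mstar sc.
  by rewrite subrKC.
have zzr : mstar z * z * r = r * (1 - c).
  apply: mult_eq => b; apply: inner_injr => a /=.
  rewrite -[LHS]/(inner a (mstar z (z (r b)))) -inner_mstar.
  have [Tr <-] := zP a; have [_ <-] := zP (r b).
  by rewrite rr (inv_one_plus_sqP _ cP Tr) inner_mstar sr.
have cE : 1 - mstar z * z = c.
  have w0 : r * (mstar z * z - (1 - c)) = 0.
    have := congr1 (@mstar R A) zzr.
    rewrite !mstarM mstarB mstar1 mstarK sr sc => E.
    by rewrite mulrBr E -rc; rewrite mulrBl mulrBr mul1r mulr1 !mulrA subrr.
  have -> : mstar z * z = 1 - c.
    apply/eqP; rewrite -subr_eq0; apply/eqP; apply: mult_eq => b.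
    apply: (dense_inner_eq0 dT) => x /domP[a ->].
    rewrite inner_mstar sr -[r _]/((r * _) b) w0.
    exact: innerr0.
  by rewrite subKr.
exists r; rewrite cE; split => //.
- exact: inv_one_plus_sq_bnd cP.
- by move=> a; have [] := zP a.
Qed.

End ZTransform.

(** * Restrictions of regular operators *)

Theorem proposition6p2 (R : realType) (A : cstarAlgType R) (hA : separable A)
  (T : operator A) (z : multiplier A) (hT : regular T) (hz : is_ztransform T z)
  (S : operator A) (zS : multiplier A) (hS : regular S)
  (hzS : is_ztransform S zS) :
  restriction S T <->
  exists u : multiplier A,
    [/\ mstar u * u = 1,
        zS = z * u
      & msqrt (mstar u * (1 - mstar z * z) * u)
        = msqrt (1 - mstar z * z) * u].
Proof.
have [[[dT _] _ _] _ _] := hT; have [[[dS _] _ _] _ _] := hS.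
have [r [b1 rP domT Tr]] := ztransformP dT hz.
have [rS [bS rSP domS SrS]] := ztransformP dS hzS.
have sr := mpos_sa rP.1; have srS := mpos_sa rSP.1.
rewrite (msqrt_unique b1 rP); split.
- move=> [dST ST].
  pose u : multiplier A := r * rS + mstar z * zS.
  have uP a : r (u a) = rS a /\ z (u a) = zS a.
    have SrSa : dom S (rS a) by apply/domS; exists a.
    have [y yE] := (domT _).1 (dST _ SrSa).
    have zy : zS a = z y by rewrite -SrS ST // yE Tr.
    have -> : u a = y.
      rewrite -[u a]/(r (rS a) + mstar z (zS a)) yE zy.
      have -> : r (r y) = (1 - mstar z * z) y by rewrite -rP.2.
      exact: subrK.
    by rewrite -yE -zy.
  have ru : r * u = rS by apply: mult_eq => a; have [] := uP a.
  have zu : z * u = zS by apply: mult_eq => a; have [] := uP a.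
  have uru : mstar u * (1 - mstar z * z) * u = rS * rS.
    by rewrite -rP.2 -{1}srS -ru mstarM sr !mulrA.
  exists u; split => //; last first.
    by rewrite ru uru rSP.2; exact: msqrt_unique bS rSP.
  have : mstar u * (1 - mstar z * z) * u = 1 - mstar zS * zS by rewrite uru rSP.2.
  rewrite -zu mstarM mulrBr mulrBl mulr1 !mulrA.
  by move=> /addIr.
- move=> [u [uu zu]].
  have -> : mstar u * (1 - mstar z * z) * u = 1 - mstar zS * zS.
    by rewrite zu mstarM mulrBr mulrBl mulr1 uu !mulrA.
  rewrite (msqrt_unique bS rSP) => rSE.
  have ST x : dom S x -> dom T x /\ S x = T x.
    move=> /domS[a ->]; split; first by apply/domT; exists (u a); rewrite rSE.
    by rewrite SrS rSE zu -[RHS]/(T (r (u a))) Tr.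
  by split=> x /ST[].
Qed.
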